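(* Let $G=(V,E)$ be a finite directed graph, $d\ge 1$, let $p_1,\dots,p_d$ be topic influence probability functions on $G$, let $1\le k\le |V|$, let $\Lambda$ be a landmark set, and let $I=(\lambda_1,\dots,\lambda_d)$ be an item with mixed influence probability function $p=\sum_{i\in[d]}\lambda_i p_i$ and $D_I^+=\{i\in[d] : \lambda_i>0\}$. If the influence spread function $\sigma(S,p)$ is $c$-sub-additive in $p$, then the Best Topic Selection (BTS) algorithm achieves approximation ratio $\frac{1-e^{-1}}{c\,|D_I^+|\,\mu_{\max}}$ for the item $I$; that is, its output $S^{\mathrm{BTS}}$ satisfies $$\sigma(S^{\mathrm{BTS}},p)\;\ge\;\frac{1-e^{-1}}{c\,|D_I^+|\,\mu_{\max}}\;\max_{S\subseteq V,\,|S|\le k}\sigma(S,p).$$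
   Context: **Independent cascade model.** $G=(V,E)$ is a finite directed graph. An influence probability function is $q:V\times V\to[0,1]$ with $q(u,v)=0$ whenever $(u,v)\notin E$ or $u=v$. Given a seed set $S\subseteq V$, the nodes of $S$ are active at time $0$. At each time $t\ge1$, every node $u$ that became active at time $t-1$ has one chance to activate each currently inactive out-neighbor $v$, succeeding independently with probability $q(u,v)$. Active nodes stay active, and the process stops when no new node is activated. The influence spread $\sigma(S,q)$ is the expected number of active nodes at the end. **Topics and items.** $[d]=\{1,\dots,d\}$. For each topic $i\in[d]$, $p_i$ is an influence probability function. An item (topic mixture) is a vector $I=(\lambda_1,\dots,\lambda_d)$ with $\lambda_i\in[0,1]$ and $\sum_i\lambda_i=1$; its influence probability function is $p=\sum_{i\in[d]}\lambda_ip_i$. **Greedy seed sets.** For an influence probability function $q$, the marginal influence is $MI(v\mid S,q)=\sigma(S\cup\{v\},q)-\sigma(S,q)$. The greedy algorithm starts with $S_0=\emptyset$, and for $j=1,\dots,k$ picks $v_j\in\arg\max_{v\in V\setminus S_{j-1}}MI(v\mid S_{j-1},q)$ (ties broken arbitrarily, marginal influences computed exactly) and sets $S_j=S_{j-1}\cup\{v_j\}$. Its output is $S^g(k,q)=S_k$. For each function $q=\lambda p_i$ used below, one greedy output $S^g(k,q)$ is fixed. **Landmarks and rounding.** A landmark set is a finite set $\Lambda=\{\lambda^c_0,\lambda^c_1,\dots,\lambda^c_m\}$ with $0=\lambda^c_0<\lambda^c_1<\cdots<\lambda^c_m=1$. For $\lambda\in[0,1]$, $\underline{\lambda}$ is the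 largest element of $\Lambda$ that is $\le\lambda$, and $\overline{\lambda}$ is the smallest element of $\Lambda$ that is $\ge\lambda$. Define $$\mu_{\max}=\max_{i\in[d],\,\lambda\in[0,1]}\frac{\sigma(S^g(k,\overline{\lambda}p_i),\overline{\lambda}p_i)}{\sigma(S^g(k,\underline{\lambda}p_i),\underline{\lambda}p_i)}.$$ **BTS algorithm.** The sets $S^g(k,\lambda p_i)$ and values $\sigma(S^g(k,\lambda p_i),\lambda p_i)$ are precomputed for all $\lambda\in\Lambda$, $i\in[d]$. Given an item $I$, the algorithm chooses $i'\in\arg\max_{i\in D_I^+}\sigma(S^g(k,\underline{\lambda_i}p_i),\underline{\lambda_i}p_i)$ and outputs $S^{\mathrm{BTS}}=S^g(k,\underline{\lambda_{i'}}p_{i'})$. **Sub-additivity.** $\sigma(S,p)$ is $c$-sub-additive in $p$, for a constant $c$, if for every $S\subseteq V$ with $|S|\le k$ and every topic mixture $I=(\lambda_1,\dots,\lambda_d)$, $\sigma\big(S,\sum_{i\in D_I^+}\lambda_ip_i\big)\le c\sum_{i\in D_I^+}\sigma(S,\lambda_ip_i)$. *)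

(* Defs.v *)
From HB Require Import structures.
From mathcomp Require Import all_boot all_order all_algebra.
From mathcomp Require Import classical_sets reals.

Set Implicit Arguments.
Unset Strict Implicit.
Unset Printing Implicit Defensive.

Import Order.TTheory GRing.Theory Num.Theory.

Local Open Scope ring_scope.

Definition influence_prob (R : realType) (V : finType) (E : rel V)
    (q : V -> V -> R) : Prop :=
  (forall u v, 0 <= q u v <= 1) /\
  (forall u v, ~~ E u v \/ u = v -> q u v = 0).

(** Independent cascade.  A state of the process is a pair (A, N): the nodes
    active so far and, among them, those that became active at the last step. *)

Definition attempts (V : finType) (x : {set V} * {set V}) : {set V * V} :=
  [set e : V * V | (e.1 \in x.2) && (e.2 \notin x.1)].

(** Probability that, among the independent attempts [T], exactly those in
    [B] (a subset of [T]) succeed.  Attempts along non-edges are harmless,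
    since they succeed with probability 0. *)
Definition outcome_prob (R : realType) (V : finType) (q : V -> V -> R)
    (T B : {set V * V}) : R :=
  (\prod_(e in B) q e.1 e.2) * (\prod_(e in T :\: B) (1 - q e.1 e.2)).

Definition next_state (V : finType) (x : {set V} * {set V})
    (B : {set V * V}) : {set V} * {set V} :=
  let new := [set e.2 | e in B] in (x.1 :|: new, new).

(** [cascade_law q S0 t x] is the probability that the process with seed set
    [S0] is in state [x] at time [t]. *)
Fixpoint cascade_law (R : realType) (V : finType) (q : V -> V -> R)
    (S0 : {set V}) (t : nat) (x : {set V} * {set V}) : R :=
  if t is t'.+1 then
    \sum_(y : {set V} * {set V})
      cascade_law q S0 t' y *
      \sum_(B : {set V * V} | (B \subset attempts y) && (next_state y B == x))
        outcome_prob q (attempts y) B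
  else (x == (S0, S0))%:R.

(** The set of active nodes grows strictly until the process stops, so it is
    final at time #|V|; states with no newly active node are absorbing. *)
Definition sigma (R : realType) (V : finType) (S0 : {set V})
    (q : V -> V -> R) : R :=
  \sum_(x : {set V} * {set V}) cascade_law q S0 #|V| x * #|x.1|%:R.

Definition scale_prob (R : realType) (V : finType) (a : R) (q : V -> V -> R) :
    V -> V -> R :=
  fun u v => a * q u v.

Definition topic_mixture (R : realType) (d : nat) (lam : 'I_d -> R) : Prop :=
  (forall i, 0 <= lam i <= 1) /\ \sum_(i < d) lam i = 1.

Definition mixed_prob (R : realType) (V : finType) (d : nat)
    (p : 'I_d -> V -> V -> R) (lam : 'I_d -> R) : V -> V -> R :=
  fun u v => \sum_(i < d) lam i * p i u v.

Definition Dplus (R : realType) (d : nat) (lam : 'I_d -> R) : {set 'I_d} :=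
  [set i | 0 < lam i].

Definition marginal_influence (R : realType) (V : finType)
    (v : V) (S : {set V}) (q : V -> V -> R) : R :=
  sigma (v |: S) q - sigma S q.

(** [greedy_output q j S]: [S] is a possible value of the greedy set after
    [j] steps, for some way of breaking ties. *)
Inductive greedy_output (R : realType) (V : finType) (q : V -> V -> R) :
    nat -> {set V} -> Prop :=
| greedy_init : greedy_output q 0 finset.set0
| greedy_step (j : nat) (S : {set V}) (v : V) :
    greedy_output q j S ->
    v \notin S ->
    (forall w, w \notin S ->
       marginal_influence w S q <= marginal_influence v S q) ->
    greedy_output q j.+1 (v |: S).

Definition landmark_set (R : realType) (m : nat) (L : 'I_m.+1 -> R) : Prop :=
  [/\ L ord0 = 0, L ord_max = 1 &
      forall i j : 'I_m.+1, (i < j)%N -> L i < L j].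

(** For [x] in [0, 1] the default values 0 and 1 are themselves landmarks in
    the range of the max (resp. min), so they do not affect the result. *)
Definition round_down (R : realType) (m : nat) (L : 'I_m.+1 -> R) (x : R) : R :=
  \big[Num.max/0]_(j < m.+1 | L j <= x) L j.

Definition round_up (R : realType) (m : nat) (L : 'I_m.+1 -> R) (x : R) : R :=
  \big[Num.min/1]_(j < m.+1 | x <= L j) L j.

(** [Sg] is the fixed choice of greedy outputs, as a function of the influence
    probabilities; the number [k] of seeds is fixed. *)
Definition greedy_choice (R : realType) (V : finType) (d m : nat)
    (p : 'I_d -> V -> V -> R) (L : 'I_m.+1 -> R)
    (Sg : (V -> V -> R) -> {set V}) (k : nat) : Prop :=
  forall (j : 'I_m.+1) (i : 'I_d),
    greedy_output (scale_prob (L j) (p i)) k (Sg (scale_prob (L j) (p i))).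

Definition greedy_spread (R : realType) (V : finType) (d : nat)
    (p : 'I_d -> V -> V -> R) (Sg : (V -> V -> R) -> {set V})
    (a : R) (i : 'I_d) : R :=
  sigma (Sg (scale_prob a (p i))) (scale_prob a (p i)).

(** The ratio takes finitely many values as [x] ranges over [0, 1], so this
    supremum is a maximum. *)
Definition mu_max (R : realType) (V : finType) (d m : nat)
    (p : 'I_d -> V -> V -> R) (L : 'I_m.+1 -> R)
    (Sg : (V -> V -> R) -> {set V}) : R :=
  sup [set r : R | exists (i : 'I_d) (x : R), 0 <= x <= 1 /\
         r = greedy_spread p Sg (round_up L x) i /
             greedy_spread p Sg (round_down L x) i]%classic.

(** Possible outputs of the algorithm, ties in the arg max being broken
    arbitrarily. *)
Definition BTS_output (R : realType) (V : finType) (d m : nat)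
    (p : 'I_d -> V -> V -> R) (L : 'I_m.+1 -> R)
    (Sg : (V -> V -> R) -> {set V}) (lam : 'I_d -> R) (S : {set V}) : Prop :=
  exists i' : 'I_d,
    [/\ i' \in Dplus lam,
        forall i, i \in Dplus lam ->
          greedy_spread p Sg (round_down L (lam i)) i <=
          greedy_spread p Sg (round_down L (lam i')) i' &
        S = Sg (scale_prob (round_down L (lam i')) (p i'))].

Definition sub_additive (R : realType) (V : finType) (d : nat)
    (p : 'I_d -> V -> V -> R) (k : nat) (c : R) : Prop :=
  forall (S : {set V}) (lam : 'I_d -> R), (#|S| <= k)%N -> topic_mixture lam ->
    sigma S (fun u v => \sum_(i in Dplus lam) lam i * p i u v) <=
    c * \sum_(i in Dplus lam) sigma S (scale_prob (lam i) (p i)).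

(* Main.v *)
(** Deferred decisions: each edge is tried at most once, so all coins can be
    tossed in advance, and the spread of [S] is the expected number of nodes
    reachable from [S] in a random live-edge graph [X].  For fixed [X] the set
    reachable from a union is the union of the reachable sets, so the spread is
    monotone and submodular in [S], hence the greedy set is within a factor
    [1 - 1/e] of the optimum; and it grows with [X], so the spread is monotone in
    the probabilities.  For an optimal set [S] this gives
    [sigma S p <= c * sum_i sigma S (lam_i p_i)], where each term is at most
    [greedy (round_up lam_i) / (1 - 1/e)
      <= mu_max * greedy (round_down lam_i) / (1 - 1/e)], itself bounded through
    the choice of the best topic [i'] and
    [round_down lam_i' * p_i' <= lam_i' * p_i' <= p]. *)

Require Import Defs.
From HB Require Import structures.
From mathcomp Require Import all_boot all_order all_algebra.
From mathcomp Require Import classical_sets reals sequences exp.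
From mathcomp Require Import fintype finset ring lra.

Set Implicit Arguments.
Unset Strict Implicit.
Unset Printing Implicit Defensive.

Import Order.TTheory GRing.Theory Num.Theory.

Local Open Scope ring_scope.

(** * Expectations over independent coins *)

Definition prob_fun (R : realType) (V : finType) (q : V -> V -> R) : Prop :=
  forall u v, 0 <= q u v <= 1.

(** The mean of [F] under the product Bernoulli measure on subsets of [T]: [B] is the random set of
    coins that succeed. *)
Definition expect (R : realType) (V : finType) (q : V -> V -> R)
    (T : {set V * V}) (F : {set V * V} -> R) : R :=
  \sum_(B : {set V * V} | B \subset T) outcome_prob q T B * F B.

Lemma set_U1_ind (T : finType) (P : {set T} -> Prop) :
  P set0 ->
  (forall (x : T) (A : {set T}), x \notin A -> P A -> P (x |: A)) ->
  forall A, P A.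
Proof.
move=> P0 PU A; have [n] := ubnP #|A|; elim: n A => // n IHn A ltAn.
have [->//|[x xA]] := set_0Vmem A.
rewrite -(setD1K xA); apply: PU; first by rewrite !inE eqxx.
by apply: IHn; move: ltAn; rewrite (cardsD1 x) xA.
Qed.

Section Expect.
Variables (R : realType) (V : finType).
Implicit Types (q : V -> V -> R) (T U B C X : {set V * V}) (e : V * V).
Implicit Types F G : {set V * V} -> R.

Lemma eq_expect q T F G : (forall B, B \subset T -> F B = G B) ->
  expect q T F = expect q T G.
Proof. by move=> eqFG; apply: eq_bigr => B sBT; rewrite eqFG. Qed.

Lemma expect0 q F : expect q set0 F = F set0.
Proof.
rewrite /expect (big_pred1 set0) => [|B]; last by rewrite subset0.
by rewrite /outcome_prob setD0 !big_set0 !mul1r.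
Qed.

(** Conditioning on the coin [e]; this recursion drives the inductions on [T]. *)
Lemma expectU1 q e T F : e \notin T ->
  expect q (e |: T) F = q e.1 e.2 * expect q T (fun B => F (e |: B)) +
    (1 - q e.1 e.2) * expect q T F.
Proof.
move=> eT; rewrite /expect (bigID (fun B => e \in B)) /=; congr (_ + _).
- rewrite (reindex_onto (fun B => e |: B) (fun B => B :\ e)) /=; last first.
    by move=> B /andP[_ eB]; rewrite setD1K.
  rewrite big_distrr /=; apply: eq_big => [B|B /andP[/andP[sB _] /eqP eqB]].
    rewrite setU11 andbT; have [eB|eB] := boolP (e \in B).
      rewrite [RHS](_ : _ = false); last first.
        by apply: contraNF eT => /subsetP; apply.
      by apply/negP => /andP[_ /eqP eqB]; move: eB; rewrite -eqB !inE eqxx.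
    rewrite setU1K // eqxx andbT subUset sub1set setU11 /=.
    apply/idP/idP => [/subsetP sB|sB]; last exact: subset_trans sB (subsetUr _ _).
    apply/subsetP => x xB; move/sB: (xB); rewrite !inE => /predU1P[xe|//].
    by rewrite -xe xB in eB.
  have eB : e \notin B by rewrite -eqB !inE eqxx.
  rewrite /outcome_prob big_setU1 //= mulrA; congr (_ * _).
  rewrite -!mulrA; congr (_ * (_ * _)); apply: eq_bigl => x.
  by rewrite !inE; case: eqP => [->|] //=; rewrite (negbTE eT) andbF.
- rewrite big_distrr /=; apply: eq_big => [B|B /andP[sB eB]].
    apply/andP/idP => [[/subsetP sB eB]|sB].
      apply/subsetP => x xB; move/sB: (xB); rewrite !inE => /predU1P[xe|//].
      by rewrite -xe xB in eB.
    split; first exact: subset_trans sB (subsetUr _ _).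
    by apply: contra eT => /(subsetP sB).
  rewrite /outcome_prob mulrA; congr (_ * _).
  rewrite [RHS]mulrCA; congr (_ * _).
  rewrite setDUl (_ : [set e] :\: B = [set e]); last first.
    by apply/setP => x; rewrite !inE; case: eqP => [->|]; rewrite ?eB ?andbF.
  by rewrite big_setU1 //= !inE (negbTE eT) andbF.
Qed.

Lemma expect_cst q T (a : R) : expect q T (fun=> a) = a.
Proof.
elim/set_U1_ind: T => [|e T eT IH]; first by rewrite expect0.
by rewrite expectU1 // IH; ring.
Qed.

Lemma expectD q T F G :
  expect q T (fun B => F B + G B) = expect q T F + expect q T G.
Proof. by rewrite /expect -big_split; apply: eq_bigr => B _; rewrite mulrDr. Qed.

Lemma expectN q T F : expect q T (fun B => - F B) = - expect q T F.
Proof. by rewrite /expect -sumrN; apply: eq_bigr => B _; rewrite mulrN. Qed.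

Lemma expect_sum (I : finType) (A : {set I}) q T (F : I -> {set V * V} -> R) :
  expect q T (fun B => \sum_(i in A) F i B) = \sum_(i in A) expect q T (F i).
Proof.
rewrite /expect exchange_big; apply: eq_bigr => B _.
by rewrite big_distrr.
Qed.

Lemma outcome_prob_ge0 q T B : prob_fun q -> 0 <= outcome_prob q T B.
Proof.
move=> q01; apply: mulr_ge0; apply: prodr_ge0 => e _.
  by have /andP[] := q01 e.1 e.2.
by rewrite subr_ge0; have /andP[] := q01 e.1 e.2.
Qed.

Lemma expect_le q T F G : prob_fun q -> (forall B, F B <= G B) ->
  expect q T F <= expect q T G.
Proof.
move=> q01 leFG; apply: ler_sum => B _; apply: ler_wpM2l => //.
exact: outcome_prob_ge0.
Qed.

(** Coins are changed one at a time: a larger success probability for [e] shifts weight to [e |: B],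
    where the monotone [F] is at least as large. *)
Lemma expect_le_prob q q' T F : prob_fun q -> prob_fun q' ->
  (forall u v, q u v <= q' u v) ->
  (forall B C, B \subset C -> F B <= F C) ->
  expect q T F <= expect q' T F.
Proof.
move=> q01 q01' leq; elim/set_U1_ind: T F => [|e T eT IH] F Fmono.
  by rewrite !expect0.
rewrite !expectU1 //.
have le1 : expect q T (fun B => F (e |: B)) <=
           expect q' T (fun B => F (e |: B)).
  by apply: IH => B C sBC; apply: Fmono; apply: setUS.
have le2 := IH F Fmono.
have le3 : expect q' T F <= expect q' T (fun B => F (e |: B)).
  by apply: expect_le => // B; apply: Fmono; apply: subsetUr.
have /andP[q0 q1] := q01 e.1 e.2; have le0 := leq e.1 e.2.
nra.
Qed.

(* Independence of the coins in [T] from those in [U]. *)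
Lemma expect_split q T U F : [disjoint T & U] ->
  expect q (T :|: U) F =
  expect q T (fun B => expect q U (fun C => F (B :|: C))).
Proof.
elim/set_U1_ind: T F => [|e T eT IH] F.
  rewrite set0U expect0 => _; apply: eq_expect => C _.
  by rewrite set0U.
rewrite -setI_eq0 setIUl setU_eq0 !setI_eq0 disjoints1 => /andP[eU dTU].
rewrite -setUA !expectU1 ?inE ?negb_or ?eT //.
rewrite !IH //; congr (_ * _ + _); apply: eq_expect => B _.
by apply: eq_expect => C _; rewrite setUA.
Qed.

End Expect.

(** * The cascade as reachability in a random live-edge graph *)

Section LiveEdge.
Variables (R : realType) (V : finType).
Implicit Types (q : V -> V -> R) (X B C : {set V * V}) (S A : {set V}).
Implicit Types (y : {set V} * {set V}) (g : {set V} * {set V} -> R).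

(** One round with the coins [X] tossed in advance: only those attempted from [y] are read. *)
Definition live_step X y := next_state y (X :&: attempts y).

Definition spread_step X A := A :|: [set e.2 | e in X & e.1 \in A].

(** The transition operator of the chain of states, acting on functions. *)
Definition cascade_op q g y := expect q (attempts y) (fun B => g (next_state y B)).

(** Duality of forward law and backward operator: the last step is absorbed into [g], which
    therefore stays general in the induction. *)
Lemma cascade_law_expect q S t g :
  \sum_x cascade_law q S t x * g x = iter t (cascade_op q) g (S, S).
Proof.
elim: t g => [|t IH] g /=.
  by rewrite (bigD1 (S, S)) //= eqxx mul1r big1 ?addr0 // => x /negbTE->;
     rewrite mul0r.
rewrite -iterS iterSr -IH.
under eq_bigr => x _ do rewrite big_distrl /=.
rewrite exchange_big /=; apply: eq_bigr => y _.
under eq_bigr => x _ do rewrite -mulrA.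
rewrite -big_distrr /=; congr (_ * _).
rewrite /cascade_op /expect.
rewrite (partition_big (next_state y) xpredT) //=; apply: eq_bigr => x _.
by rewrite big_distrl /=; apply: eq_bigr => B /andP[_ /eqP->].
Qed.

(* A node fires only once: the edges leaving a set [C] of nodes that are active
   but not newly active are never examined again. *)
Lemma eq_iter_live_step X X' (C : {set V}) n y :
  (forall e, e.1 \notin C -> (e \in X) = (e \in X')) ->
  C \subset y.1 -> [disjoint C & y.2] ->
  iter n (live_step X) y = iter n (live_step X') y.
Proof.
move=> eqX; elim: n y => // n IH y sC dC; rewrite !iterSr.
have eqI : X :&: attempts y = X' :&: attempts y.
  apply/setP => e; rewrite !inE.
  have [eN|] := boolP (e.1 \in y.2); last by rewrite !andbF.
  by rewrite eqX // (disjointFl dC eN).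
have -> : live_step X' y = live_step X y by rewrite /live_step eqI.
apply: IH => /=.
  exact: subset_trans sC (subsetUl _ _).
rewrite disjoint_subset; apply/subsetP => v vC; rewrite inE.
apply/imsetP => -[e]; rewrite !inE => /and3P[_ _ e2A] ev.
by move: e2A; rewrite -ev (subsetP sC).
Qed.

(** The first round reads the coins of [T] and no later round reads them again, so fresh coins at
    each round and a single toss of all coins give the same mean. *)
Lemma iter_cascade_op q g n y : y.2 \subset y.1 ->
  iter n (cascade_op q) g y =
  expect q setT (fun X => g (iter n (live_step X) y)).
Proof.
elim: n y => [|n IH] y sy /=; first by rewrite expect_cst.
set T := attempts y.
have dT : [disjoint T & ~: T] by rewrite -setI_eq0 setICr.
have splitT F : expect q setT F =
    expect q T (fun B => expect q (~: T) (fun C => F (B :|: C))).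
  by rewrite -(setUCr T) expect_split.
rewrite splitT; apply: eq_expect => B sB.
have dB v : v \in (next_state y B).2 -> v \notin y.1.
  by move=> /imsetP[e /(subsetP sB) eT ->]; move: eT; rewrite inE => /andP[].
rewrite IH; last exact: subsetUr.
(* The induction hypothesis tosses the coins of [T] afresh, as [B']. Averaging the right side over a
   dummy [B'] allows a comparison for fixed [B], [B'] and [C]. *)
rewrite splitT -[RHS](expect_cst q T).
apply: eq_expect => B' sB'; apply: eq_expect => C sC; rewrite -iterS iterSr.
have -> : live_step (B :|: C) y = next_state y B.
  rewrite /live_step setIUl (setIidPl sB) (_ : C :&: _ = set0) ?setU0 //.
  by apply/eqP; rewrite setI_eq0 disjoints_subset.
congr g; apply: (@eq_iter_live_step _ _ y.1).
(* [B] and [B'] contain only edges leaving [y.1], so they cannot differ at [e]. *)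
- move=> e eA; rewrite !inE; congr (_ || _).
  have eT : e \notin T.
    by rewrite inE negb_and; apply/orP; left; apply: contra eA => /(subsetP sy).
  by rewrite (contraNF (subsetP sB e) eT) (contraNF (subsetP sB' e) eT).
- exact: subsetUl.
- by rewrite disjoint_sym disjoint_subset; apply/subsetP => v /dB; rewrite inE.
Qed.

(* Non-frontier active nodes have all their live out-neighbours active, so
   expanding the frontier is the same as expanding the whole active set. *)
Lemma iter_live_step_spread X n y : y.2 \subset y.1 ->
  (forall e, e \in X -> e.1 \in y.1 -> e.1 \notin y.2 -> e.2 \in y.1) ->
  (iter n (live_step X) y).1 = iter n (spread_step X) y.1.
Proof.
elim: n y => // n IH y sy hy; rewrite !iterSr IH.
- congr iter; apply/setP => v; rewrite !inE.
  have [//|vA] /= := boolP (v \in y.1).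
  apply/imsetP/imsetP => -[e].
    rewrite !inE => /and3P[eX e1 e2] ->; exists e => //.
    by rewrite inE eX (subsetP sy).
  rewrite inE => /andP[eX e1] ev; exists e => //.
  have e2 : e.2 \notin y.1 by rewrite -ev.
  rewrite !inE eX e2 andbT /=; apply: contraNT e2; exact: hy.
- exact: subsetUr.
- move=> e eX /=; rewrite !inE => e1 e2; move: e1.
  rewrite (negbTE e2) orbF => e1.
  have [//|e2A] /= := boolP (e.2 \in y.1).
  apply/imsetP; exists e => //; rewrite !inE eX e2A andbT /=.
  by apply: contraNT e2A; exact: hy.
Qed.

(** The number of rounds matches the horizon of [sigma]. *)
Definition reach X S := iter #|V| (spread_step X) S.

Lemma sigma_expect S q : sigma S q = expect q setT (fun X => #|reach X S|%:R).
Proof.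
rewrite /sigma (cascade_law_expect q S #|V| (fun x => #|x.1|%:R)).
rewrite iter_cascade_op //; apply: eq_expect => X _; congr (_%:R).
(* Initially every active node is newly active, so the frontier condition is vacuous. *)
by rewrite iter_live_step_spread //= => e _ ->.
Qed.

Lemma spread_stepU X S A :
  spread_step X (S :|: A) = spread_step X S :|: spread_step X A.
Proof.
rewrite /spread_step setUACA -imsetU; congr (_ :|: _).
have -> // : [set e in X | e.1 \in S :|: A] =
             [set e in X | e.1 \in S] :|: [set e in X | e.1 \in A].
by apply/setP => e; rewrite !inE -andb_orr.
Qed.

Lemma reachU X S A : reach X (S :|: A) = reach X S :|: reach X A.
Proof. by rewrite /reach; elim: #|V| => //= n ->; exact: spread_stepU. Qed.

Lemma sub_reach X S : S \subset reach X S.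
Proof.
by rewrite /reach; elim: #|V| => //= n IH; apply: subset_trans IH (subsetUl _ _).
Qed.

Lemma reach_mono X X' S : X \subset X' -> reach X S \subset reach X' S.
Proof.
move=> /subsetP sX; rewrite /reach; elim: #|V| => //= n IH.
apply: setUSS => //; apply: imsetS; apply/subsetP => e; rewrite !inE.
by case/andP => /sX-> /(subsetP IH).
Qed.

(** Submodularity in the form greedy needs: the gain of [v] counts the nodes it reaches outside
    [reach X S], and over [v] in [A] these cover [reach X A :\: reach X S]. *)
Lemma reach_card_le X S A :
  #|reach X A|%:R <= #|reach X S|%:R +
    \sum_(v in A) (#|reach X (v |: S)|%:R - #|reach X S|%:R) :> R.
Proof.
have cardU v : #|reach X (v |: S)|%:R - #|reach X S|%:R =
    #|reach X [set v] :\: reach X S|%:R :> R.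
  rewrite reachU -(cardsID (reach X S) (reach X [set v] :|: reach X S)).
  by rewrite setIC setKU setDUl setDv setU0 natrD addrC addKr.
under eq_bigr => v _ do rewrite cardU.
rewrite -natr_sum -natrD ler_nat.
apply: (@leq_trans (#|reach X S| + #|reach X A :\: reach X S|)).
  rewrite -(cardsID (reach X S) (reach X A)) leq_add2r.
  by apply: subset_leq_card; exact: subsetIr.
rewrite leq_add2l; elim/set_U1_ind: A => [|x A xA IH].
  by rewrite big_set0 leqn0 cards_eq0 setD_eq0 -[S]set0U reachU subsetUl.
rewrite big_setU1 //= reachU setDUl; apply: leq_trans (leq_card_setU _ _) _.
by rewrite leq_add2l.
Qed.

(** * Bounds and monotonicity of the spread *)

Lemma sigma_ge_card S q : prob_fun q -> #|S|%:R <= sigma S q.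
Proof.
move=> q01; rewrite sigma_expect -(expect_cst q setT #|S|%:R).
by apply: expect_le => // X; rewrite ler_nat subset_leq_card ?sub_reach.
Qed.

Lemma sigma_ge0 S q : prob_fun q -> 0 <= sigma S q.
Proof. by move=> q01; apply: le_trans (sigma_ge_card S q01). Qed.

Lemma sigma_le_card S q : prob_fun q -> sigma S q <= #|V|%:R.
Proof.
move=> q01; rewrite sigma_expect -(expect_cst q setT #|V|%:R).
by apply: expect_le => // X; rewrite ler_nat max_card.
Qed.

Lemma sigma_le_prob S q q' : prob_fun q -> prob_fun q' ->
  (forall u v, q u v <= q' u v) -> sigma S q <= sigma S q'.
Proof.
move=> q01 q01' leq; rewrite !sigma_expect; apply: expect_le_prob => // B C sBC.
by rewrite ler_nat subset_leq_card ?reach_mono.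
Qed.

Lemma marginal_influence_ge0 v S q : prob_fun q -> 0 <= marginal_influence v S q.
Proof.
move=> q01; rewrite subr_ge0 !sigma_expect; apply: expect_le => // X.
by rewrite ler_nat subset_leq_card // reachU subsetUr.
Qed.

Lemma sigma_le_marginals A S q : prob_fun q ->
  sigma A q <= sigma S q + \sum_(v in A) marginal_influence v S q.
Proof.
move=> q01; rewrite /marginal_influence !sigma_expect.
under eq_bigr => v _ do rewrite sigma_expect -expectN -expectD.
rewrite -expect_sum -expectD; apply: expect_le => // X; exact: reach_card_le.
Qed.

(** * The greedy guarantee *)

Lemma greedy_output_card q j S : greedy_output q j S -> #|S| = j.
Proof. by elim=> [|{}j {}S v _ IH vS _]; rewrite ?cards0 // cardsU1 vS IH. Qed.

Lemma greedy_step_le q S v k A : prob_fun q -> (0 < k)%N -> (#|A| <= k)%N ->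
  (forall w, w \notin S -> marginal_influence w S q <= marginal_influence v S q) ->
  sigma A q <= sigma S q + k%:R * marginal_influence v S q.
Proof.
move=> q01 k0 cA vmax; apply: le_trans (sigma_le_marginals A S q01) _.
rewrite lerD2l; have m0 := marginal_influence_ge0 v S q01.
apply: (@le_trans _ _ (\sum_(w in A) marginal_influence v S q)).
  (* A node already in [S] gains nothing, so [m0] covers it. *)
  apply: ler_sum => w _; have [wS|/vmax//] := boolP (w \in S).
  by rewrite {1}/marginal_influence (setUidPr _) ?sub1set // subrr.
by rewrite sumr_const -[leLHS]mulr_natl ler_wpM2r ?ler_nat.
Qed.

(** Each greedy node closes at least a fraction [1/k] of the gap to [sigma A q]. *)
Lemma greedy_output_le q j S k A : prob_fun q -> (0 < k)%N -> (#|A| <= k)%N ->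
  greedy_output q j S ->
  sigma A q - sigma S q <= (1 - k%:R^-1) ^+ j * sigma A q.
Proof.
move=> q01 k0 cA; elim=> [|{}j {}S v _ IH vS vmax].
  by rewrite expr0 mul1r gerBl sigma_ge0.
have kR : 0 < k%:R :> R by rewrite ltr0n.
have step := greedy_step_le q01 k0 cA vmax.
have le1k : 0 <= 1 - k%:R^-1 :> R by rewrite subr_ge0 invf_le1 // ler1n.
rewrite exprS -mulrA; apply: le_trans (ler_wpM2l le1k IH).
have kV : k%:R * (1 - k%:R^-1) = k%:R - 1 :> R by field; rewrite gt_eqF.
(* Multiplying by [k] clears the inverse and leaves a linear consequence of [step]. *)
rewrite -(ler_pM2l kR) [leRHS]mulrA kV.
by move: step; rewrite /marginal_influence; lra.
Qed.

Lemma greedy_approx q S k A : prob_fun q -> (0 < k)%N -> (#|A| <= k)%N ->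
  greedy_output q k S -> (1 - expR (- 1)) * sigma A q <= sigma S q.
Proof.
move=> q01 k0 cA gS.
have le1k : 0 <= 1 - k%:R^-1 :> R by rewrite subr_ge0 invf_le1 ?ltr0n // ler1n.
(* From [1 + x <= expR x] at [x = - 1/k], raised to the power [k]. *)
have lek : (1 - k%:R^-1) ^+ k <= expR (- 1) :> R.
  have -> : -1 = k%:R * - k%:R^-1 :> R.
    by rewrite mulrN divff // pnatr_eq0 -lt0n.
  by rewrite expRM_natl; apply: lerXn2r; rewrite ?nnegrE ?expR_ge0 // expR_ge1Dx.
have := greedy_output_le q01 k0 cA gS.
have := ler_wpM2r (sigma_ge0 A q01) lek; lra.
Qed.

End LiveEdge.

(** * Rounding to landmarks *)

Section Rounding.
Variables (R : realType) (m : nat) (L : 'I_m.+1 -> R).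
Hypothesis hL : landmark_set L.

Lemma landmark_ge0 j : 0 <= L j.
Proof.
case: hL => L0 _ Lmono; have [->|j0] := eqVneq j ord0; first by rewrite L0.
by rewrite -L0 ltW // Lmono // lt0n.
Qed.

Lemma landmark_le1 j : L j <= 1.
Proof.
case: hL => _ L1 Lmono; have [->|jm] := eqVneq j ord_max; first by rewrite L1.
by rewrite -L1 ltW // Lmono // ltn_neqAle leq_ord jm.
Qed.

(** Rounded values are landmarks, which is where greedy outputs are provided. *)
Lemma round_down_landmark x : 0 <= x ->
  exists2 j, round_down L x = L j & L j <= x.
Proof.
move=> x0; rewrite /round_down.
elim/big_ind: _ => [|_ _ [i -> ix] [j -> jx]|j jx]; last by exists j.
- by case: hL => L0 _ _; exists ord0; rewrite ?L0.
- by case: leP => _; [exists j|exists i].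
Qed.

Lemma round_up_landmark x : x <= 1 ->
  exists2 j, round_up L x = L j & x <= L j.
Proof.
move=> x1; rewrite /round_up.
elim/big_ind: _ => [|_ _ [i -> ix] [j -> jx]|j jx]; last by exists j.
- by case: hL => _ L1 _; exists ord_max; rewrite ?L1.
- by case: leP => _; [exists i|exists j].
Qed.

End Rounding.

Lemma prob_fun_scale (R : realType) (V : finType) (a : R) (q : V -> V -> R) :
  prob_fun q -> 0 <= a <= 1 -> prob_fun (scale_prob a q).
Proof.
move=> q01 /andP[a0 a1] u v; have /andP[q0 q1] := q01 u v.
by rewrite /scale_prob mulr_ge0 // mulr_ile1.
Qed.

(** * Topic mixtures *)

Section Topics.
Variables (R : realType) (V : finType) (d : nat) (p : 'I_d -> V -> V -> R).
Hypothesis p01 : forall i, prob_fun (p i).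
Variables (lam : 'I_d -> R).
Hypothesis hlam : topic_mixture lam.

Lemma mixed_prob_Dplus u v :
  mixed_prob p lam u v = \sum_(i in Dplus lam) lam i * p i u v.
Proof.
rewrite /mixed_prob [RHS]big_mkcond; apply: eq_bigr => i _; rewrite inE.
case: hlam => l01 _; have /andP[] := l01 i.
by rewrite le_eqVlt => /predU1P[<-|->//]; rewrite ltxx mul0r.
Qed.

Lemma prob_fun_mixed : prob_fun (mixed_prob p lam).
Proof.
case: hlam => l01 l1 u v; apply/andP; split.
  apply: sumr_ge0 => i _; apply: mulr_ge0; first by have /andP[] := l01 i.
  by have /andP[] := p01 i u v.
rewrite -l1; apply: ler_sum => i _; apply: ler_piMr.
  by have /andP[] := l01 i.
by have /andP[] := p01 i u v.
Qed.

Lemma scale_prob_le_mixed a i u v : a <= lam i ->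
  scale_prob a (p i) u v <= mixed_prob p lam u v.
Proof.
move=> ai; case: hlam => l01 _; rewrite /mixed_prob (bigD1 i) //=.
have /andP[pi0 _] := p01 i u v.
apply: (@le_trans _ _ (lam i * p i u v)); first exact: ler_wpM2r.
rewrite lerDl; apply: sumr_ge0 => j _; apply: mulr_ge0.
  by have /andP[] := l01 j.
by have /andP[] := p01 j u v.
Qed.

(** A single seed has spread at least 1 under the mixture, while the topic spreads are nonnegative,
    so [c <= 0] would contradict sub-additivity. *)
Lemma sub_additive_gt0 k (c : R) : (1 <= k <= #|V|)%N ->
  sub_additive p k c -> 0 < c.
Proof.
move=> /andP[k1 kV] hc.
have [v _] : exists v, v \in V by apply/card_gt0P; exact: leq_trans kV.
have cv : (#|[set v]| <= k)%N by rewrite cards1.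
have q01 : prob_fun (fun u v => \sum_(i in Dplus lam) lam i * p i u v).
  by move=> u w; rewrite -mixed_prob_Dplus; exact: prob_fun_mixed.
have := le_trans (sigma_ge_card [set v] q01) (hc _ _ cv hlam).
rewrite cards1 => h; rewrite ltNge; apply/negP => c0.
have s0 : 0 <= \sum_(i in Dplus lam) sigma [set v] (scale_prob (lam i) (p i)).
  apply: sumr_ge0 => i _; apply/sigma_ge0/prob_fun_scale => //.
  by case: hlam.
have := mulr_ge0_le0 s0 c0; rewrite mulrC => h'.
by have := le_trans h h'; rewrite ler10.
Qed.

(** * The ratio [mu_max] and the selected topic *)

Section Landmarks.
Variables (m : nat) (L : 'I_m.+1 -> R) (Sg : (V -> V -> R) -> {set V}) (k : nat).
Hypotheses (hL : landmark_set L) (k0 : (0 < k)%N).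
Hypothesis hSg : greedy_choice p L Sg k.

Lemma prob_fun_landmark j i : prob_fun (scale_prob (L j) (p i)).
Proof.
by apply: prob_fun_scale => //; rewrite landmark_ge0 // landmark_le1.
Qed.

(** The seeds alone contribute [k]; this keeps the denominators in [mu_max] positive, even at
    landmark 0. *)
Lemma greedy_spread_ge j i : k%:R <= greedy_spread p Sg (L j) i.
Proof.
rewrite -(greedy_output_card (hSg j i)); apply: sigma_ge_card.
exact: prob_fun_landmark.
Qed.

Lemma greedy_spread_gt0 j i : 0 < greedy_spread p Sg (L j) i.
Proof. by apply: lt_le_trans (greedy_spread_ge j i); rewrite ltr0n. Qed.

Lemma mu_max_ge i x : 0 <= x <= 1 ->
  greedy_spread p Sg (round_up L x) i / greedy_spread p Sg (round_down L x) i
    <= mu_max p L Sg.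
Proof.
move=> x01; apply: ub_le_sup; last by exists i, x.
(* Each ratio has numerator at most [#|V|] and denominator at least [k >= 1], so the supremum is a
   genuine upper bound. *)
exists #|V|%:R => _ [i' [y [/andP[y0 y1] ->]]].
have [j -> _] := round_down_landmark hL y0.
have [j' -> _] := round_up_landmark hL y1.
rewrite ler_pdivrMr ?greedy_spread_gt0 //.
apply: le_trans (sigma_le_card _ (prob_fun_landmark j' i')) _.
apply: ler_peMr => //; apply: le_trans (greedy_spread_ge j i').
by rewrite ler1n.
Qed.

Lemma greedy_spread_round_up_le i x : 0 <= x <= 1 ->
  greedy_spread p Sg (round_up L x) i <=
  mu_max p L Sg * greedy_spread p Sg (round_down L x) i.
Proof.
move=> x01; have /andP[x0 _] := x01; rewrite -ler_pdivrMr ?mu_max_ge //.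
by have [j -> _] := round_down_landmark hL x0; exact: greedy_spread_gt0.
Qed.

Lemma mu_max_gt0 (i : 'I_d) : 0 < mu_max p L Sg.
Proof.
have x01 : (0 : R) <= (0 : R) <= 1 by rewrite lexx ler01.
apply: lt_le_trans (mu_max_ge i x01).
have [j -> _] := round_down_landmark hL (lexx 0).
have [j' -> _] := round_up_landmark hL ler01.
by rewrite divr_gt0 ?greedy_spread_gt0.
Qed.

(** Rounding [lam i] up cannot lower the spread of [S]; greedy is near-optimal at that landmark, and
    [mu_max] pays for rounding down instead. *)
Lemma sigma_topic_le i (S : {set V}) : (#|S| <= k)%N ->
  (1 - expR (- 1)) * sigma S (scale_prob (lam i) (p i)) <=
  mu_max p L Sg * greedy_spread p Sg (round_down L (lam i)) i.
Proof.
move=> cS; case: hlam => l01 _; have li := l01 i; have /andP[li0 li1] := li.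
apply: le_trans (greedy_spread_round_up_le i li).
have [j -> lj] := round_up_landmark hL li1.
apply: le_trans (greedy_approx (prob_fun_landmark j i) k0 cS (hSg j i)).
apply: ler_wpM2l; first by rewrite subr_ge0 expR_le1 lerN10.
apply: sigma_le_prob; [exact: prob_fun_scale|exact: prob_fun_landmark|].
by move=> u v; apply: ler_wpM2r => //; have /andP[] := p01 i u v.
Qed.

Lemma sigma_mixed_le (c : R) (SBTS S : {set V}) :
  0 <= c -> sub_additive p k c -> BTS_output p L Sg lam SBTS -> (#|S| <= k)%N ->
  (1 - expR (- 1)) * sigma S (mixed_prob p lam) <=
  c * #|Dplus lam|%:R * mu_max p L Sg * sigma SBTS (mixed_prob p lam).
Proof.
move=> c0 hc [i' [i'D i'max SE]] cS.
have e0 : 0 <= 1 - expR (- 1) :> R by rewrite subr_ge0 expR_le1 lerN10.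
have mu0 := ltW (mu_max_gt0 i').
(* The output is greedy for a function lying pointwise below the mixture. *)
have leBTS : greedy_spread p Sg (round_down L (lam i')) i' <=
    sigma SBTS (mixed_prob p lam).
  case: hlam => l01 _; have /andP[li0 _] := l01 i'.
  rewrite SE /greedy_spread; have [j -> lj] := round_down_landmark hL li0.
  apply: sigma_le_prob; [exact: prob_fun_landmark|exact: prob_fun_mixed|].
  by move=> u v; exact: scale_prob_le_mixed.
have sub : sigma S (mixed_prob p lam) <=
    c * \sum_(i in Dplus lam) sigma S (scale_prob (lam i) (p i)).
  apply: le_trans (hc S lam cS hlam); apply: sigma_le_prob.
  - exact: prob_fun_mixed.
  - by move=> u v; rewrite -mixed_prob_Dplus; exact: prob_fun_mixed.
  - by move=> u v; rewrite mixed_prob_Dplus.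
apply: le_trans (ler_wpM2l e0 sub) _.
rewrite mulrCA -!mulrA; apply: ler_wpM2l => //.
(* All [#|Dplus lam|] terms are compared with one common bound, by the choice of [i']. *)
rewrite big_distrr /= mulr_natl -sumr_const; apply: ler_sum => i iD.
apply: le_trans (sigma_topic_le i cS) _; apply: ler_wpM2l => //.
exact: le_trans (i'max i iD) leBTS.
Qed.

End Landmarks.
End Topics.

Theorem theorem4p1 (R : realType) (V : finType) (E : rel V) (d : nat)
    (hd : (1 <= d)%N)
    (p : 'I_d -> V -> V -> R) (hp : forall i, influence_prob E (p i))
    (k : nat) (hk : (1 <= k <= #|V|)%N)
    (m : nat) (L : 'I_m.+1 -> R) (hL : landmark_set L)
    (Sg : (V -> V -> R) -> {set V}) (hSg : greedy_choice p L Sg k)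
    (lam : 'I_d -> R) (hlam : topic_mixture lam)
    (c : R) (hc : sub_additive p k c)
    (SBTS : {set V}) (hBTS : BTS_output p L Sg lam SBTS) :
  sigma SBTS (mixed_prob p lam) >=
    (1 - expR (- 1)) / (c * #|Dplus lam|%:R * mu_max p L Sg) *
    \big[Num.max/0]_(S : {set V} | (#|S| <= k)%N) sigma S (mixed_prob p lam).
Proof.
have p01 i : prob_fun (p i) by case: (hp i).
have k0 : (0 < k)%N by case/andP: hk.
have [i' [i'D _ _]] := hBTS.
have c0 := sub_additive_gt0 p01 hlam hk hc.
have D0 : 0 < #|Dplus lam|%:R :> R by rewrite ltr0n; apply/card_gt0P; exists i'.
have mu0 := mu_max_gt0 p01 hL k0 hSg i'.
have e0 : 0 < 1 - expR (- 1) :> R by rewrite subr_gt0 expR_lt1 ltrN10.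
have K0 : 0 < c * #|Dplus lam|%:R * mu_max p L Sg by rewrite !mulr_gt0.
(* Isolating the maximum reduces the claim to one bound per set [S]. *)
rewrite mulrAC ler_pdivrMr // [leLHS]mulrC [leRHS]mulrC -ler_pdivlMr //.
apply: bigmax_le => [|S cS].
  (* The default 0 of the maximum must satisfy the bound too. *)
  rewrite divr_ge0 ?(ltW e0) // mulr_ge0 ?(ltW K0) //.
  exact/sigma_ge0/prob_fun_mixed.
rewrite ler_pdivlMr // [leLHS]mulrC.
exact: (sigma_mixed_le p01 hlam hL k0 hSg (ltW c0) hc hBTS cS).
Qed.
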